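(* Let $\mathcal{S}$ be a non-degenerate thick-lined polar space of rank at least $2$ (possibly infinite). Let $N$ and $N'$ be sub-generators of $\mathcal{S}$ (possibly $N=N'$) and let $\{a,b\}$ and $\{c,d\}$ be two pairs of opposite points, both contained in $(N\cup N')^\perp$. Assume that it is not the case that simultaneously $\mathcal{S}$ is non-embeddable of rank $2$, $N=N'$, and the stabilizer in $\mathrm{Aut}(\mathcal{S})$ of the point $p:=N=N'$ acts intransitively on the set of hyperbolic lines of $\mathcal{S}$ contained in $p^\perp$. Then $(N\cup N')^\perp=\langle (N\cap N')\cup\{a,b\}^{\perp\perp}\rangle$ if and only if $(N\cup N')^\perp=\langle (N\cap N')\cup\{c,d\}^{\perp\perp}\rangle$.
   Context: Two points are collinear ($\perp$) if equal or on a common line; for a set $X$ of points $X^\perp$ is the set of points collinear with all points of $X$, $X^{\perp\perp}=(X^\perp)^\perp$; $\langle X\rangle$ is the subspace generated by $X$. Generators are maximal singular subspaces (singular = pairwise collinear points). A sub-generator is a singular subspace which is a hyperplane of some (equivalently every) generator containing it; in rank 2 sub-generators are points. Opposite points are non-collinear points; a hyperbolic line is a set $\{a,b\}^{\perp\perp}$ with $a,b$ opposite. $\mathcal{S}$ is embeddable if it admits a full projective embedding (an injective map of the point set into the points of a projective space, with spanning image, mapping lines onto lines). *)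

(* Defs.v *)
From mathcomp Require Import all_boot.
From mathcomp Require Import boolp classical_sets.

Set Implicit Arguments.
Unset Strict Implicit.
Unset Printing Implicit Defensive.

Local Open Scope classical_set_scope.

Record geometry := Geometry {
  point :> Type;
  line : set (set point)
}.

Section Geometry.
Variable S : geometry.
Implicit Types (x y : S) (l X M H : set S) (n : nat).

Definition collinear x y : Prop :=
  x = y \/ exists l, [/\ line l, l x & l y].

Definition opposite x y : Prop := ~ collinear x y.

Definition perp X : set S := [set y | forall x, X x -> collinear x y].

Definition subspace X : Prop :=
  forall l x y, line l -> l x -> l y -> x <> y -> X x -> X y -> l `<=` X.

Definition span X : set S := smallest subspace X.

Definition singular X : Prop := forall x y, X x -> X y -> collinear x y.

Definition singular_subspace X : Prop := subspace X /\ singular X.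

Definition generator M : Prop :=
  singular_subspace M /\
  forall X, singular_subspace X -> M `<=` X -> X = M.

(* A hyperplane of the subspace [M]: a proper subspace of [M] meeting every line
   of [M]. *)
Definition hyperplane_of M H : Prop :=
  [/\ subspace H, H `<` M &
      forall l, line l -> l `<=` M -> (H `&` l) !=set0].

Definition sub_generator H : Prop :=
  singular_subspace H /\ exists M, generator M /\ hyperplane_of M H.

Definition thick_lined : Prop :=
  forall l, line l ->
    exists x y z, [/\ l x, l y & l z] /\ [/\ x <> y, x <> z & y <> z].

(* Buekenhout-Shult one-or-all axiom; together with non-degeneracy it implies
   that two distinct points are on at most one line. *)
Definition polar_space : Prop :=
  forall x l, line l ->
    l `<=` collinear x \/ exists! y, l y /\ collinear x y.

Definition nondegenerate : Prop := perp [set: S] = set0.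

(* The rank is the supremum of the lengths [n] of the strictly increasing chains
   X 0 < X 1 < ... < X n of singular subspaces (X 0 may be empty, so that it is
   the projective dimension of the generators plus one). *)
Definition rank_ge n : Prop :=
  exists X : nat -> set S,
    (forall i, i <= n -> singular_subspace (X i)) /\
    (forall i, i < n -> X i `<` X i.+1).

Definition rank_eq n : Prop := rank_ge n /\ ~ rank_ge n.+1.

Definition hyperbolic_line : set (set S) :=
  [set h | exists a b, opposite a b /\ h = perp (perp [set a; b])].

Definition automorphism (g : S -> S) : Prop :=
  bijective g /\ forall l, line l <-> line (g @` l).

Definition stabilizer_transitive (p : S) : Prop :=
  forall h k,
    hyperbolic_line h -> h `<=` perp [set p] ->
    hyperbolic_line k -> k `<=` perp [set p] ->
    exists g, [/\ automorphism g, g p = p & g @` h = k].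

(* Possibly non-Desarguesian and of infinite dimension; the last clause is the
   Veblen-Young axiom. *)
Definition projective_space : Prop :=
  [/\ thick_lined,
      forall x y, x <> y -> exists! l, [/\ line l, l x & l y] &
      forall (p a b c d : S) (l1 l2 m1 m2 : set S),
        line l1 -> line l2 -> line m1 -> line m2 -> l1 <> l2 ->
        [/\ l1 p, l1 a & l1 b] -> [/\ l2 p, l2 c & l2 d] ->
        [/\ a <> p, b <> p, c <> p & d <> p] ->
        m1 a -> m1 c -> m2 b -> m2 d ->
        (m1 `&` m2) !=set0].

End Geometry.

Definition full_projective_embedding (S PG : geometry) (e : S -> PG) : Prop :=
  [/\ injective e,
      span (range e) = [set: PG] &
      forall l, line l -> line (e @` l)].

Definition embeddable (S : geometry) : Prop :=
  exists (PG : geometry) (e : S -> PG),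
    projective_space PG /\ full_projective_embedding e.

(* Main.v *)
(* Let R be the intersection of N and N', and X the perp of their union. Lines
   of X meet R, so collinearity is an equivalence relation on the points of X
   off R, and X is spanned by R and {a,b}^perp^perp iff this hyperbolic line
   meets every class up to collinearity. Replacing a and b by points of their
   hyperbolic line collinear with c and d, it suffices to let b slide to d on a
   line through a point r of R, and to show that {a,d}^perp^perp meets each line
   joining r to a point z of {a,b}^perp^perp. Points x of {a,b}^perp correspond
   to points x' = ax /\ d^perp of {a,d}^perp, so the point w of rz collinear
   with x' must not depend on x.
   - If {a,b}^perp contains lines (rank at least 3), w is constant along lines
     of {a,b}^perp: if u = xy /\ r^perp, then x'y' passes through u, which is
     collinear with w. Points off r^perp are connected by such lines.
   - If S is embedded, let T(x) be the span of x^perp, a hyperplane that meets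
     S in x^perp. The point k of the projective line bz in T(a) lies in T(x) and
     T(a), hence in T(x'); so does d, and w is the intersection of dk and rz.
   - In the remaining case the rank is 2, N = N' is a point, and an automorphism
     fixing it carries one hyperbolic line to the other. *)
Require Import Defs.
From mathcomp Require Import all_boot.
From mathcomp Require Import boolp classical_sets.

Set Implicit Arguments.
Unset Strict Implicit.

Local Open Scope classical_set_scope.

Local Notation "x _|_ y" := (collinear x y) (at level 70, no associativity).

(** * Polar spaces *)

Section Collinearity.
Variable S : geometry.
Implicit Types (x y z : S) (l X Y : set S).

Lemma collinear_refl x : x _|_ x.
Proof. by left. Qed.

Lemma collinear_sym x y : x _|_ y -> y _|_ x.
Proof. by case=> [->|[l [ll lx ly]]]; [left|right; exists l]. Qed.

Lemma collinear_on l x y : line l -> l x -> l y -> x _|_ y.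
Proof. by move=> ll lx ly; right; exists l. Qed.

Lemma collinear_line x y :
  x _|_ y -> x <> y -> exists l, [/\ line l, l x & l y].
Proof. by case. Qed.

Lemma perp2E a b x : perp [set a; b] x <-> a _|_ x /\ b _|_ x.
Proof.
split=> [h|[ha hb] y [->|->] //].
by split; apply: h; [left|right].
Qed.

Lemma perp1E a x : perp [set a] x <-> a _|_ x.
Proof. by split=> [|h y ->]; first exact. Qed.

Lemma perpU X Y x : perp (X `|` Y) x <-> perp X x /\ perp Y x.
Proof.
split=> [h|[hX hY] y [/hX|/hY]] //.
by split=> y hy; apply: h; [left|right].
Qed.

Lemma perpS X Y : X `<=` Y -> perp Y `<=` perp X.
Proof. by move=> XY x h y /XY /h. Qed.

Lemma perp_sym X Y : X `<=` perp Y -> Y `<=` perp X.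
Proof. by move=> h y Yy x /h /(_ y Yy) /collinear_sym. Qed.

Lemma sub_perpK X : X `<=` perp (perp X).
Proof. exact: perp_sym. Qed.

Lemma subspaceI X Y : subspace X -> subspace Y -> subspace (X `&` Y).
Proof.
move=> sX sY l x y ll lx ly xy [Xx Yx] [Xy Yy] t lt; split.
- exact: sX xy Xx Xy t lt.
- exact: sY xy Yx Yy t lt.
Qed.

Lemma span_subspace X : subspace (span X).
Proof.
move=> l x y ll lx ly xy hx hy t lt M MX; have [sM XM] := MX.
by apply: (sM l x y) => //; [apply: hx|apply: hy].
Qed.

Lemma sub_span X : X `<=` span X.
Proof. exact: sub_gen_smallest. Qed.

Lemma span_sub X Y : subspace Y -> X `<=` Y -> span X `<=` Y.
Proof. exact: smallest_sub. Qed.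

End Collinearity.

Definition nondeg_on (S : geometry) (P : set S) : Prop :=
  forall x, P x -> exists2 v, P v & ~ x _|_ v.

(** For a subspace [P] this means that [P] contains a line. *)
Definition spans_line (S : geometry) (P : set S) : Prop :=
  exists x y, [/\ P x, P y, x _|_ y & x <> y].

(* When [b] slides along the line [rb], the hyperbolic line on [a] and [b]
   is moved along the lines on [r]. *)
Definition sliding (S : geometry) (r : S) : Prop :=
  forall a b d z l, ~ a _|_ b -> perp [set a; b] r ->
    line l -> l r -> l b -> l d -> d <> r ->
    perp (perp [set a; b]) z ->
  exists2 w, perp (perp [set a; d]) w & exists m, [/\ line m, m r, m z & m w].

Section PolarSpace.
Variable S : geometry.
Hypotheses (polar_S : polar_space S) (thick_S : thick_lined S).
Implicit Types (x y z a b t u v w : S) (l m n : set S) (P X : set S).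

Lemma line_two l x : line l -> exists2 y, l y & y <> x.
Proof.
move=> /thick_S [p [q [r [[lp lq _] [pq _ _]]]]].
have [px|px] := pselect (p = x); last by exists p.
by exists q => // qx; apply: pq; rewrite px qx.
Qed.

Lemma line_third l x y : line l -> exists z, [/\ l z, z <> x & z <> y].
Proof.
move=> /thick_S [p [q [r [[lp lq lr] [pq pr qr]]]]].
have [px|px] := pselect (p = x).
  have [qy|qy] := pselect (q = y).
    by exists r; split => // rx; [apply: pr|apply: qr]; congruence.
  by exists q; split => // qx; apply: pq; congruence.
have [py|py] := pselect (p = y); last by exists p.
have [qx|qx] := pselect (q = x).
  by exists r; split => // rx; [apply: qr|apply: pr]; congruence.
by exists q; split => // qy; apply: pq; congruence.
Qed.

Lemma line_proj l x : line l -> exists2 y, l y & x _|_ y.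
Proof.
move=> ll; have [h|[y [[ly xy] _]]] := polar_S x ll; last by exists y.
by have [y ly _] := line_two x ll; exists y => //; apply: h.
Qed.

Lemma line_all l x y z t : line l -> l y -> l z -> l t -> y <> z ->
  x _|_ y -> x _|_ z -> x _|_ t.
Proof.
move=> ll ly lz lt yz xy xz; have [h|[u [_ h]]] := polar_S x ll; first exact: h.
by case: yz; rewrite -(h y) // -(h z).
Qed.

Lemma subspace_perp X : subspace (perp X).
Proof.
move=> l x y ll lx ly xy hx hy t lt u Xu.
by apply: (line_all ll lx ly lt xy); [apply: hx|apply: hy].
Qed.

Lemma span_perp X Y : X `<=` perp Y -> span X `<=` perp (span Y).
Proof.
move=> XY; apply: span_sub; first exact: subspace_perp.
apply: perp_sym; apply: span_sub; first exact: subspace_perp.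
exact: perp_sym.
Qed.

(** Otherwise every point of [P] collinear with [x] is collinear with the whole line [l] on [x] and
    [y]. Project [u], opposite [y], to [w] on [l], and [u'], opposite [w], to [v] on the line [m] on
    [u] and [w]. The point [k] collinear with [x] on the line of [u'] and [v] differs from [v], and
    both are collinear with [w]; hence so is [u'], a contradiction. *)
Lemma perp_separates P x y : subspace P -> nondeg_on P -> P x -> P y ->
  x <> y -> exists v, [/\ P v, v _|_ x & ~ v _|_ y].
Proof.
move=> sP nP Px Py xy.
have [[v hv]|no] := pselect (exists v, [/\ P v, v _|_ x & ~ v _|_ y]).
  by exists v.
have {}no v : P v -> v _|_ x -> v _|_ y.
  by move=> Pv vx; apply: contrapT => vy; apply: no; exists v.
have [u Pu yu] := nP y Py.
have ux : ~ u _|_ x by move=> /(no _ Pu)/collinear_sym.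
have [l [ll lx ly]] := collinear_line (no x Px (collinear_refl x)) xy.
have [w lw uw] := line_proj u ll.
have wx : w <> x by move=> wx; apply: ux; rewrite -wx.
have Pw : P w by apply: (sP l x y).
have [u' Pu' wu'] := nP w Pw.
have ux' : ~ u' _|_ x.
  move=> h; apply: wu'; apply: collinear_sym.
  by apply: (line_all ll lx ly lw xy h); apply: no.
have uDw : u <> w by move=> e; apply: ux; rewrite e; apply: collinear_on lw lx.
have [m [ml mu mw]] := collinear_line uw uDw.
have [v mv u'v] := line_proj u' ml.
have vw : v <> w by move=> e; apply: wu'; rewrite -e; apply: collinear_sym.
have vx : ~ v _|_ x.
  move=> vx; apply: ux; apply: collinear_sym.
  apply: (line_all ml mv mw mu vw); apply: collinear_sym => //.
  exact: collinear_on lw lx.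
have Pv : P v by apply: (sP m u w).
have u'Dv : u' <> v.
  by move=> e; apply: wu'; rewrite e; apply: collinear_on mw mv.
have [n [nl nu' nv]] := collinear_line u'v u'Dv.
have [k nk xk] := line_proj x nl.
have Pk : P k by apply: (sP n u' v).
have kv : k <> v by move=> e; apply: vx; rewrite -e; apply: collinear_sym.
case: wu'; apply: (line_all nl nk nv nu' kv); last exact: collinear_on mw mv.
apply: collinear_sym; apply: (line_all ll lx ly lw xy);
  first exact: collinear_sym.
by apply: no => //; apply: collinear_sym.
Qed.

(** * Uniqueness of lines and the Veblen-Young property of singular subspaces *)

Hypothesis nondeg_S : nondegenerate S.

Lemma subspaceT : subspace [set: S].
Proof. by []. Qed.

Lemma nondeg_onT : nondeg_on [set: S].
Proof.
move=> x _; apply: contrapT => h.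
have : perp [set: S] x.
  move=> y _; apply: contrapT => yx; apply: h; exists y => //.
  by move=> /collinear_sym.
by rewrite nondeg_S.
Qed.

(** For [z] on [m] off [l], take [u] collinear with [z] but not with [x], its projection [s] on [l],
    then [g] collinear with [s] but not with [z], and its projection [h] on the line of [u] and [z].
    The projection [q] of [x] on the line of [g] and [h] is collinear with [s] and [x], hence with
    [l], hence with [z]. So [z] is collinear with [q] and [h], and therefore with [g]. *)
Lemma line_sub l m x y : line l -> line m -> x <> y -> l x -> l y -> m x ->
  m y -> m `<=` l.
Proof.
move=> ll ml xy lx ly mx my z mz; apply: contrapT => lz.
have [u [_ uz ux]] := perp_separates subspaceT nondeg_onT
  (I : setT z) (I : setT x) (fun e => lz (eq_ind_r l lx e)).
have [s ls us] := line_proj u ll.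
have sz : s <> z by move=> e; apply: lz; rewrite -e.
have sDx : s <> x by move=> e; apply: ux; rewrite -e.
have [g [_ gs gz]] := perp_separates subspaceT nondeg_onT
  (I : setT s) (I : setT z) sz.
have zl t : l t -> z _|_ t.
  move=> lt; apply: (line_all ll lx ly lt xy); exact: collinear_on mz _.
have uDz : u <> z by move=> e; apply: ux; rewrite e; apply: collinear_on mz mx.
have [n [nl nu nz]] := collinear_line uz uDz.
have [h nh gh] := line_proj g nl.
have hz : h <> z by move=> e; apply: gz; rewrite -e.
have hx : ~ h _|_ x.
  move=> hx; apply: ux; apply: collinear_sym.
  by apply: (line_all nl nh nz nu hz); apply: collinear_sym => //; apply: zl.
have sh : s _|_ h.
  by apply: (line_all nl nu nz nh uDz); apply: collinear_sym => //; apply: zl.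
have gDh : g <> h by move=> e; apply: gz; rewrite e; apply: collinear_on nh nz.
have [k [kl kg kh]] := collinear_line gh gDh.
have [q kq xq] := line_proj x kl.
have qh : q <> h by move=> e; apply: hx; rewrite -e; apply: collinear_sym.
have sq : s _|_ q.
  by apply: (line_all kl kg kh kq gDh) => //; apply: collinear_sym.
have ql t : l t -> q _|_ t.
  by move=> lt; apply: (line_all ll ls lx lt sDx); apply: collinear_sym.
have qz : q _|_ z.
  apply: (line_all ml mx my mz xy); exact: ql.
apply: gz; apply: collinear_sym.
apply: (line_all kl kq kh kg qh); first exact: collinear_sym.
exact: collinear_on nz nh.
Qed.

Lemma line_eq l m x y : line l -> line m -> x <> y -> l x -> l y -> m x ->
  m y -> l = m.
Proof. by move=> *; apply/seteqP; split; apply: (@line_sub _ _ x y). Qed.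

Lemma proj_unique l x y z t : line l -> l y -> l z -> l t -> ~ x _|_ t ->
  x _|_ y -> x _|_ z -> y = z.
Proof.
move=> ll ly lz lt xt xy xz; apply: contrapT => yz; apply: xt.
exact: (line_all ll ly lz lt yz).
Qed.

(** If [u] were collinear with the whole trace, choose [g] collinear with [x] but not with [u]. The
    line on [g] and [x] has a second point [h] in the trace, and collinearity of [u] with [h] and
    [x] extends to [g]. *)
Lemma perp2_nondeg P x y : subspace P -> nondeg_on P -> P x -> P y ->
  ~ x _|_ y -> nondeg_on (P `&` perp [set x; y]).
Proof.
move=> sP nP Px Py xy u [Pu /perp2E [xu yu]]; apply: contrapT => no.
have ux : x <> u by move=> e; apply: xy; rewrite e; apply: collinear_sym.
have [g [Pg gx gu]] := perp_separates sP nP Px Pu ux.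
have gDx : g <> x by move=> e; apply: gu; rewrite e.
have [l [ll lg lx]] := collinear_line gx gDx.
have [h lh yh] := line_proj y ll.
have hx : h <> x by move=> e; apply: xy; rewrite -e; apply: collinear_sym.
have uh : u _|_ h.
  apply: contrapT => uh; apply: no; exists h => //; split.
    exact: (sP l g x ll lg lx gDx Pg Px).
  by apply/perp2E; split => //; apply: collinear_on lx lh.
apply: gu; apply: collinear_sym.
by apply: (line_all ll lh lx lg hx uh); apply: collinear_sym.
Qed.

Lemma opposite_exists x : exists y, ~ x _|_ y.
Proof. by have [y _] := nondeg_onT (I : setT x); exists y. Qed.

(** With [y] collinear with [c2] but not with [c], the trace of [c] and [y] is nondegenerate and
    contains [c2] and a point [x'] of the line on [x] and [c]. A point of this trace separating [c2]
    from [x'] is collinear with [c] and [c2], hence with [l], but not with [x]. *)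
Lemma line_separates l x : line l -> ~ l x -> (forall t, l t -> x _|_ t) ->
  exists v, (forall t, l t -> v _|_ t) /\ ~ v _|_ x.
Proof.
move=> ll lx xl; have [c [c2 [_ [[lc lc2 _] [cc2 _ _]]]]] := thick_S ll.
have [y [_ yc2 yc]] := perp_separates subspaceT nondeg_onT
  (I : setT c2) (I : setT c) (fun e => cc2 (esym e)).
have xDc : x <> c by move=> e; apply: lx; rewrite e.
have [m [ml mx mc]] := collinear_line (xl c lc) xDc.
have [x' mx' yx'] := line_proj y ml.
have x'c : x' <> c by move=> e; apply: yc; rewrite -e.
pose P := [set: S] `&` perp [set c; y].
have sP : subspace P by apply: subspaceI subspaceT _; apply: subspace_perp.
have cy : ~ c _|_ y by move=> /collinear_sym.
have nP : nondeg_on P by apply: (perp2_nondeg subspaceT nondeg_onT I I cy).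
have Pc2 : P c2.
  by split => //; apply/perp2E; split => //; apply: collinear_on lc lc2.
have Px' : P x'.
  by split => //; apply/perp2E; split => //; apply: collinear_on mc mx'.
have c2x' : c2 <> x'.
  move=> e; apply: lx; rewrite (line_eq ll ml cc2) -?e //.
  by rewrite e.
have [v [[_ /perp2E [cv yv]] vc2 vx']] := perp_separates sP nP Pc2 Px' c2x'.
exists v; split.
  move=> t lt; apply: (line_all ll lc lc2 lt cc2) => //; exact: collinear_sym.
move=> vx; apply: vx'; apply: (line_all ml mx mc mx' xDc) => //.
exact: collinear_sym.
Qed.

(* Singular subspaces are projective: if [s] on [m2] is not on [m1], a point
   [v] in perp of [m1] but not of [s], and a point [u] in perp of [m1] but not
   of [p], lead to a point collinear with [l1], [l2] and hence [m2], which
   forces [v] to be collinear with [s]. *)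
Lemma singular_veblen p a b c d l1 l2 m1 m2 :
  line l1 -> line l2 -> line m1 -> line m2 -> l1 <> l2 ->
  [/\ l1 p, l1 a & l1 b] -> [/\ l2 p, l2 c & l2 d] ->
  [/\ a <> p, b <> p, c <> p & d <> p] ->
  m1 a -> m1 c -> m2 b -> m2 d ->
  (forall x y, l1 x -> l2 y -> x _|_ y) ->
  exists2 x, m1 x & m2 x.
Proof.
move=> ll1 ll2 lm1 lm2 l12 [l1p l1a l1b] [l2p l2c l2d] [ap bp cp dp].
move=> m1a m1c m2b m2d l1l2.
have meet x : l1 x -> l2 x -> x = p.
  move=> l1x l2x; apply: contrapT => xp; apply: l12.
  exact: (line_eq ll1 ll2 xp).
have ac : a <> c by move=> e; apply: ap; apply: meet => //; rewrite e.
have bd : b <> d by move=> e; apply: bp; apply: meet => //; rewrite e.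
have m2col x : x _|_ p -> x _|_ a -> x _|_ c -> forall t, m2 t -> x _|_ t.
  move=> xp xa xc t m2t; apply: (line_all lm2 m2b m2d m2t bd).
    exact: (line_all ll1 l1p l1a l1b (fun e => ap (esym e))).
  exact: (line_all ll2 l2p l2c l2d (fun e => cp (esym e))).
have m1m2 x y : m1 x -> m2 y -> x _|_ y.
  move=> m1x m2y; apply: m2col => //; apply: collinear_sym.
  - apply: (line_all lm1 m1a m1c m1x ac); last exact: collinear_on l2p l2c.
    exact: collinear_on l1p l1a.
  - by apply: (line_all lm1 m1a m1c m1x ac); [left|apply: l1l2].
  - apply: (line_all lm1 m1a m1c m1x ac); last by left.
    by apply: collinear_sym; apply: l1l2.
have m1p : ~ m1 p.
  move=> m1p; apply: l12; rewrite (line_eq ll1 lm1 ap) //.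
  exact: (line_eq lm1 ll2 cp).
have pm1 t : m1 t -> p _|_ t.
  move=> m1t; apply: (line_all lm1 m1a m1c m1t ac).
    exact: collinear_on l1p l1a.
  exact: collinear_on l2p l2c.
have [u [um1 up]] := line_separates lm1 m1p pm1.
have [s m2s us] := line_proj u lm2.
have [m1s|m1s] := pselect (m1 s); first by exists s.
have sm1 t : m1 t -> s _|_ t by move=> m1t; apply: collinear_sym; apply: m1m2.
have [v [vm1 vs]] := line_separates lm1 m1s sm1.
have sp : s _|_ p.
  apply: collinear_sym; apply: (m2col p _ _ _ s m2s) => //; first by left.
    exact: pm1.
  exact: pm1.
have uDs : u <> s by move=> e; apply: up; rewrite e.
have [n [nl nu ns]] := collinear_line us uDs.
have [w nw vw] := line_proj v nl.
have ws : w <> s by move=> e; apply: vs; rewrite -e.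
have wp : ~ w _|_ p.
  move=> wp; apply: up; apply: collinear_sym.
  by apply: (line_all nl nw ns nu ws); apply: collinear_sym.
have wm1 t : m1 t -> w _|_ t.
  move=> m1t; apply: collinear_sym.
  by apply: (line_all nl nu ns nw uDs); apply: collinear_sym;
     [apply: um1|apply: sm1].
have vDw : v <> w by move=> e; apply: vs; rewrite e; apply: collinear_on nw ns.
have [k [kl kv kw]] := collinear_line vw vDw.
have [q kq pq] := line_proj p kl.
have qw : q <> w by move=> e; apply: wp; rewrite -e; apply: collinear_sym.
have qm1 t : m1 t -> q _|_ t.
  move=> m1t; apply: collinear_sym.
  by apply: (line_all kl kv kw kq vDw); apply: collinear_sym;
     [apply: vm1|apply: wm1].
have qs : q _|_ s.
  by apply: (m2col q) => //; [apply: collinear_sym|apply: qm1|apply: qm1].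
case: vs; apply: collinear_sym.
apply: (line_all kl kq kw kv qw); first exact: collinear_sym.
exact: collinear_on ns nw.
Qed.

Lemma line_through P x : subspace P ->
  spans_line P -> P x ->
  exists l, [/\ line l, l x & l `<=` P].
Proof.
move=> sP [q1 [q2 [Pq1 Pq2 q12 q12D]]] Px.
have [m [ml mq1 mq2]] := collinear_line q12 q12D.
have [q mq xq] := line_proj x ml.
have Pq : P q by apply: (sP m q1 q2).
have [xDq|xDq] := pselect (x = q).
  by exists m; split; rewrite ?xDq //; apply: (sP m q1 q2).
have [l [ll lx lq]] := collinear_line xq xDq.
by exists l; split => //; apply: (sP l x q).
Qed.

(* The points of [P] off the perp of [r] are joined by paths of at most three
   lines. *)
Lemma off_perp_ind P r (Q : S -> Prop) : subspace P -> nondeg_on P ->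
  spans_line P ->
  (forall x y, P x -> P y -> ~ r _|_ x -> ~ r _|_ y -> x _|_ y -> x <> y ->
     Q x -> Q y) ->
  forall x y, P x -> P y -> ~ r _|_ x -> ~ r _|_ y -> Q x -> Q y.
Proof.
move=> sP nP exl step x y Px Py rx ry Qx.
have {}step s t : P s -> P t -> ~ r _|_ s -> ~ r _|_ t -> s _|_ t -> Q s -> Q t.
  move=> Ps Pt rs rt st Qs; have [<- //|sDt] := pselect (s = t).
  exact: step st sDt Qs.
have [xy|xy] := pselect (x _|_ y); first exact: step Qx.
have [l [ll lx lP]] := line_through sP exl Px.
have [e le ye] := line_proj y ll.
have [re|re] := pselect (r _|_ e); last first.
  have Qe : Q e by apply: (step x) => //; [apply: lP|apply: collinear_on lx le].
  by apply: (step e) => //; [apply: lP|apply: collinear_sym].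
have xe : x <> e by move=> h; apply: rx; rewrite h.
(* The projection [e] of [y] is in the perp of [r], so a detour is needed: unless [f], opposite [e]
   in the trace of [x] and [y], already serves, the path is [x], [u], [g], [y] with [g] on the line
   of [y] and [f]. *)
have [u [lu ux ue]] := line_third x e ll.
have ru : ~ r _|_ u.
  by move=> ru; apply: rx; apply: (line_all ll lu le lx ue).
have Pu : P u by apply: lP.
have Qu : Q u by apply: (step x) => //; apply: collinear_on lx lu.
have Pe : (P `&` perp [set x; y]) e.
  by split; [apply: lP|apply/perp2E; split => //; apply: collinear_on lx le].
have [f [Pf /perp2E [xf yf]] ef] := perp2_nondeg sP nP Px Py xy Pe.
have [rf|rf] := pselect (r _|_ f); last first.
  have Qf : Q f by apply: (step x).
  by apply: (step f) => //; apply: collinear_sym.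
have yDf : y <> f by move=> h; apply: ry; rewrite h.
have [m [ml my mf]] := collinear_line yf yDf.
have [g mg ug] := line_proj u ml.
have gf : g <> f.
  move=> h; apply: ef; apply: collinear_sym.
  apply: (line_all ll lx lu le (fun e => ux (esym e)));
    apply: collinear_sym => //.
  by rewrite -h.
have rg : ~ r _|_ g.
  by move=> rg; apply: ry; apply: (line_all ml mg mf my gf).
have Pg : P g by apply: (sP m y f).
have Qg : Q g by apply: (step u).
by apply: (step g) => //; apply: collinear_on mg my.
Qed.

(** * Traces and hyperbolic lines *)

Section HyperbolicLine.
Variables a b : S.
Hypothesis opp_ab : ~ a _|_ b.
Let P := perp [set a; b].

Lemma trace_nondeg : nondeg_on P.
Proof.
rewrite -[P]setTI; apply: perp2_nondeg => //.
exact: nondeg_onT.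
Qed.

Lemma hyperbolic_disjoint x : perp P x -> ~ P x.
Proof.
move=> hx Px; have [v Pv xv] := trace_nondeg Px; apply: xv.
by apply: collinear_sym; apply: hx.
Qed.

(** If [u] is collinear with [a'] and [b] but not with [a], the line on [b] and [u] has a point
    [v <> u] in the trace; [a'] is collinear with [u] and [v], hence with [b]. *)
Lemma trace_shift a' : perp P a' -> ~ a' _|_ b -> perp [set a'; b] = P.
Proof.
move=> ha' a'b; apply/seteqP; split=> u /perp2E [a'u bu]; last first.
  by apply/perp2E; split => //; apply: collinear_sym; apply: ha'; apply/perp2E.
apply/perp2E; split => //; apply: contrapT => au.
have bDu : b <> u by move=> e; apply: a'b; rewrite e.
have [l [ll lb lu]] := collinear_line bu bDu.
have [v lv av] := line_proj a ll.
have vu : v <> u by move=> e; apply: au; rewrite -e.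
apply: a'b; apply: (line_all ll lv lu lb vu) => //.
apply: collinear_sym; apply: ha'; apply/perp2E; split => //.
exact: collinear_on lb lv.
Qed.

End HyperbolicLine.

(** The points are exchanged one at a time by [trace_shift]. Up to swapping [a] and [b], [a'] is
    opposite [b], because no point of the hyperbolic line lies in the trace. *)
Lemma trace_eq a b a' b' : ~ a _|_ b -> ~ a' _|_ b' ->
  perp (perp [set a; b]) a' -> perp (perp [set a; b]) b' ->
  perp [set a'; b'] = perp [set a; b].
Proof.
move=> ab a'b'; wlog a'b : a b ab / ~ a' _|_ b.
  move=> wl ha' hb'; have [a'b|a'b] := pselect (a' _|_ b); last exact: wl.
  have ba : ~ b _|_ a by move=> /collinear_sym.
  rewrite [in RHS]setUC; apply: wl => //; rewrite 1?setUC //.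
  move=> a'a; apply: (hyperbolic_disjoint ab ha').
  by apply/perp2E; split; apply: collinear_sym.
move=> ha' hb'; have e := trace_shift ha' a'b.
rewrite -e setUC [in RHS]setUC; apply: trace_shift;
  last by move=> /collinear_sym.
by rewrite setUC e.
Qed.

Lemma proper_point X Y : X `<` Y -> exists2 x, Y x & ~ X x.
Proof.
move=> [_ YX]; apply: contrapT => no; apply: YX => x Yx.
by apply: contrapT => Xx; apply: no; exists x.
Qed.

Lemma rank2_spans_line : rank_ge S 2 -> spans_line [set: S].
Proof.
move=> [X [sX ltX]].
have [p1 p1X _] := proper_point (ltX 0 isT).
have [p2 p2X p2X'] := proper_point (ltX 1 isT).
exists p1, p2; split => //; last by move=> e; apply: p2X'; rewrite -e.
by apply: (sX 2 isT).2 => //; apply: (ltX 1 isT).1.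
Qed.

(** By [key], two lines on [a] in a singular plane suffice: the projections of [b] on them are
    distinct collinear points of the trace. The plane is found in [X 3], or joins [a] to a line of
    [X 3]. *)
Lemma rank3_trace_spans_line a b : rank_ge S 3 -> ~ a _|_ b ->
  spans_line (perp [set a; b]).
Proof.
move=> [X [sX ltX]] ab.
have [p1 p1X _] := proper_point (ltX 0 isT).
have [p2 p2X p2X'] := proper_point (ltX 1 isT).
have [p3 p3X p3X'] := proper_point (ltX 2 isT).
have p12 : p1 <> p2 by move=> e; apply: p2X'; rewrite -e.
have {}p1X : X 2 p1 by apply: (ltX 1 isT).1.
have sing x y : X 3 x -> X 3 y -> x _|_ y by apply: (sX 3 isT).2.
have {}ltX : X 2 `<=` X 3 := (ltX 2 isT).1.
have [l [ll lp1 lp2]] := collinear_line (sing _ _ (ltX _ p1X) (ltX _ p2X)) p12.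
have lp3 : ~ l p3.
  by move=> lp3; apply: p3X'; apply: ((sX 2 isT).1 l p1 p2).
have key q p n : a _|_ q -> a <> q -> line n -> n a -> n q -> a _|_ p ->
    ~ n p -> q _|_ p -> spans_line (perp [set a; b]).
  move=> aq aDq ln na nq ap np qp.
  have aDp : a <> p by move=> e; apply: np; rewrite -e.
  have [n' [ln' n'a n'p]] := collinear_line ap aDp.
  have [u nu bu] := line_proj b ln.
  have [v n'v bv] := line_proj b ln'.
  have ua : u <> a by move=> e; apply: ab; rewrite -e; apply: collinear_sym.
  have va : v <> a by move=> e; apply: ab; rewrite -e; apply: collinear_sym.
  exists u, v; split.
  - by apply/perp2E; split => //; apply: collinear_on na nu.
  - by apply/perp2E; split => //; apply: collinear_on n'a n'v.
  - have pn : p _|_ u.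
      by apply: (line_all ln na nq nu aDq); apply: collinear_sym.
    apply: (line_all ln' n'a n'p n'v aDp); last exact: collinear_sym.
    exact: collinear_on nu na.
  - move=> e; apply: np; rewrite (line_eq ln ln' ua) // e //.
pose V := X 3; have sV : subspace V := (sX 3 isT).1.
have V1 : V p1 by apply: ltX.
have V2 : V p2 by apply: ltX.
(* [q2] is found on a line joining [p3] to a point of [l] other than [q1]; such a line misses
   [q1]. *)
have [q1 [q2 [Vq1 Vq2 aq1 aq2 q12]]] :
    exists q1 q2, [/\ V q1, V q2, a _|_ q1, a _|_ q2 & q1 <> q2].
  have [q1 lq1 aq1] := line_proj a ll.
  have Vq1 : V q1 by apply: (sV l p1 p2).
  have [p [lp pq1]] : exists p, l p /\ p <> q1.
    by have [y ly yq1] := line_two q1 ll; exists y.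
  have Vp : V p by apply: (sV l p1 p2).
  have pp3 : p <> p3 by move=> e; apply: lp3; rewrite -e.
  have [n [ln np np3]] := collinear_line (sing _ _ Vp p3X) pp3.
  have [q2 nq2 aq2] := line_proj a ln.
  exists q1, q2; split => //; first exact: (sV n p p3).
  move=> e; apply: lp3; rewrite (line_eq ll ln pq1) // e //.
have [n [ln nq1 nq2]] := collinear_line (sing _ _ Vq1 Vq2) q12.
have [na|na] := pselect (n a); last first.
  have aDq1 : a <> q1 by move=> e; apply: na; rewrite e.
  have [n' [ln' n'a n'q1]] := collinear_line aq1 aDq1.
  apply: (key q1 q2 n') => //; last exact: sing.
  by move=> n'q2; apply: na; rewrite (line_eq ln ln' q12).
have Va : V a by apply: (sV n q1 q2).
have [q [nq qa]] : exists q, n q /\ q <> a.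
  by have [y ny ya] := line_two a ln; exists y.
have Vq : V q by apply: (sV n q1 q2).
have [p [Vp np]] : exists p, V p /\ ~ n p.
  apply: contrapT => no.
  have nV t : V t -> n t by move=> Vt; apply: contrapT => nt; apply: no;
    exists t.
  by apply: lp3; rewrite (line_eq ll ln p12) //; apply: nV.
by apply: (key q p n) => //; [exact: sing|exact: nesym|exact: sing|exact: sing].
Qed.

Lemma trace_sliding (r : S) : (forall a b, ~ a _|_ b -> spans_line (perp [set
  a; b])) ->
  sliding r.
Proof.
move=> spanP a b d z l ab Pr ll lr lb ld dr Hz.
pose P := perp [set a; b]; have [ar br] := (perp2E a b r).1 Pr.
have sP : subspace P by apply: subspace_perp.
have nP : nondeg_on P by apply: trace_nondeg.
have bDr : b <> r by move=> e; apply: ab; rewrite e.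
have rz : r _|_ z by apply: Hz.
have rDz : r <> z by move=> e; apply: (hyperbolic_disjoint ab Hz); rewrite -e.
have [m [lm mr mz]] := collinear_line rz rDz.
have [db|db] := pselect (d = b); first by rewrite db; exists z => //; exists m.
have ad : ~ a _|_ d.
  by move=> ad; apply: ab; apply: (line_all ll ld lr lb dr ad).
have da : ~ d _|_ a by move=> /collinear_sym.
have ba : ~ b _|_ a by move=> /collinear_sym.
have perp_d x : b _|_ x -> r _|_ x -> d _|_ x.
  move=> bx rx; apply: collinear_sym.
  by apply: (line_all ll lr lb ld (nesym bDr)); apply: collinear_sym.
have perp_r x : b _|_ x -> d _|_ x -> r _|_ x.
  move=> bx dx; apply: collinear_sym.
  by apply: (line_all ll lb ld lr (nesym db)); apply: collinear_sym.
have [x0 Px0 rx0] := nP r Pr.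
have aDP x : P x -> a <> x.
  by move=> /perp2E [_ bx] e; apply: ba; rewrite e.
have [n0 [ln0 n0a n0x0]] :=
  collinear_line ((perp2E a b x0).1 Px0).1 (aDP _ Px0).
have [x0' n0x0' dx0'] := line_proj d ln0.
have [w mw x0'w] := line_proj x0' lm.
(* [Q y] says that the point of the trace of [a] and [d] corresponding to [y] is collinear with [w],
   which was chosen for [x0]. *)
pose Q y := forall n y', line n -> n a -> n y -> n y' -> d _|_ y' -> y' _|_ w.
have Qx0 : Q x0.
  move=> n y' ln na nx0 ny' dy';
    have e := line_eq ln0 ln (aDP _ Px0) n0a n0x0 na nx0.
  rewrite -e in ny'; have -> // : y' = x0'.
  exact: (proj_unique ln0 _ _ n0a da).
have step x y : P x -> P y -> ~ r _|_ x -> ~ r _|_ y -> x _|_ y -> x <> y ->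
    Q x -> Q y.
  move=> Px Py rx ry xy xDy Qx n y' ln na ny ny' dy'.
  have [[ax bx] [ay b_y]] := ((perp2E a b x).1 Px, (perp2E a b y).1 Py).
  have [k [kl kx ky]] := collinear_line xy xDy.
  have kP : k `<=` P by apply: (sP k x y).
  have [u ku ru] := line_proj r kl.
  have Pu := kP _ ku; have [au bu] := (perp2E a b u).1 Pu.
  have ux : u <> x by move=> e; apply: rx; rewrite -e.
  have [h [lh ha hx]] := collinear_line ax (aDP _ Px).
  have [x' hx' dx'] := line_proj d lh.
  have x'x : x' <> x by move=> e; apply: rx; apply: perp_r => //; rewrite -e.
  have hP t : h t -> P t -> t = x.
    move=> ht Pt; apply: (proj_unique lh ht hx ha ba) => //.
    by have [] := (perp2E a b t).1 Pt.
  have ux' : u <> x'.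
    by move=> e; apply: x'x; apply: hP => //; rewrite -e.
  have hk s t : k s -> h t -> s _|_ t.
    move=> ks ht; apply: (line_all lh ha hx ht (aDP _ Px)).
      by apply: collinear_sym; have [] := (perp2E a b s).1 (kP _ ks).
    exact: collinear_on ks kx.
  have [g [lg gu gx']] := collinear_line (hk _ _ ku hx') ux'.
  have kh : k <> h by move=> e; apply: (aDP a) => //; apply: kP; rewrite e.
  (* In the singular plane on [a], [x], [y], the line [g] on [u] and [x'] meets the line [n] on [a]
     and [y]. The meeting point is [y'], since [d] is collinear with [u] and [x']; and [w] is
     collinear with [u] and [x'], hence with [y']. *)
  have [y'' gy'' ny''] := singular_veblen kl lh lg ln kh (And3 kx ku ky)
    (And3 hx hx' ha) (And4 ux (nesym xDy) x'x (aDP _ Px)) gu gx' ny na hk.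
  have dy'' : d _|_ y'' by apply: (line_all lg gu gx' gy'' ux') => //;
    apply: perp_d.
  have -> : y' = y'' by apply: (proj_unique ln _ _ na da).
  apply: collinear_sym; apply: (line_all lg gu gx' gy'' ux');
    apply: collinear_sym.
    apply: (line_all lm mr mz mw rDz); first exact: collinear_sym.
    exact: Hz.
  exact: (Qx h).
exists w; last by exists m.
move=> y' /perp2E [ay' dy'].
have aDy' : a <> y' by move=> e; apply: da; rewrite e.
have [n [ln na ny']] := collinear_line ay' aDy'.
have [y ny b_y] := line_proj b ln.
have Py : P y by apply/perp2E; split => //; apply: collinear_on na ny.
have [ry|ry] := pselect (r _|_ y); last first.
  have Qy : Q y by apply: (off_perp_ind sP nP (spanP a b ab) step Px0 Py).
  exact: (Qy n).
(* If [r _|_ y], the point [y] is its own correspondent, and it is collinear with all of [m]. *)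
have -> : y' = y by apply: (proj_unique ln _ _ na da) => //; apply: perp_d.
apply: (line_all lm mr mz mw rDz); first exact: collinear_sym.
exact: Hz.
Qed.

End PolarSpace.

(** * Tangent hyperplanes of embedded polar spaces *)

Section Projective.
Variable PG : geometry.
Hypothesis proj_PG : projective_space PG.
Implicit Types (x y z t k : PG) (l m : set PG) (Y : set PG).

Lemma proj_line x y : x <> y -> exists l, [/\ line l, l x & l y].
Proof. by case: proj_PG => _ h _ /h [l [hl _]]; exists l. Qed.

Lemma proj_line_eq l m x y : line l -> line m -> x <> y -> l x -> l y -> m x ->
  m y -> l = m.
Proof.
case: proj_PG => _ h _ ll lm xy lx ly mx my.
by have [n [_ nE]] := h _ _ xy; rewrite -(nE l) // -(nE m).
Qed.

(** The join of a subspace [Y] and a point [z] outside it. The vertex is listed separately so that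
    it belongs to the cone even when [Y] is empty. *)
Definition cone Y z : set PG :=
  [set t | t = z \/ exists y l, [/\ Y y, line l, l z, l y & l t]].

Variables (Y : set PG) (z : PG).
Hypotheses (sY : subspace Y) (Yz : ~ Y z).

Let neqz y : Y y -> y <> z.
Proof. by move=> Yy e; apply: Yz; rewrite -e. Qed.

Lemma cone_vertex : cone Y z z.
Proof. by left. Qed.

Lemma sub_cone : Y `<=` cone Y z.
Proof.
move=> y Yy; have [l [ll ly lz]] := proj_line (neqz Yy).
by right; exists y, l.
Qed.

(** Thus [Y] is a hyperplane of the cone. In the generic case [t1] and [t2] lie on distinct lines
    from [z] to [y1] and [y2], and the Veblen-Young axiom at [z] makes [l] meet the line on [y1] and
    [y2]. *)
Lemma cone_line_meets l t1 t2 : line l -> t1 <> t2 -> l t1 -> l t2 ->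
  cone Y z t1 -> cone Y z t2 -> exists2 k, Y k & l k.
Proof.
move=> ll t12 lt1 lt2.
have vertex t m y : t <> z -> l t -> l z -> Y y -> line m -> m z -> m y -> m t
  ->
    exists2 k, Y k & l k.
  move=> tz lt lz Yy lm mz my mt; exists y => //.
  by rewrite (proj_line_eq ll lm tz).
have [t1z|t1z] := pselect (t1 = z).
  move=> _ [t2z|[y [m [Yy lm mz my mt]]]]; first by case: t12; rewrite t2z.
  by apply: (vertex t2 m y) => //; [move=> e; apply: t12;
    rewrite e|rewrite -t1z].
case=> // -[y1 [l1 [Yy1 ll1 l1z l1y1 l1t1]]].
have [t2z _|t2z] := pselect (t2 = z).
  by apply: (vertex t1 l1 y1) => //; rewrite -t2z.
case=> // -[y2 [l2 [Yy2 ll2 l2z l2y2 l2t2]]].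
have [l12|l12] := pselect (l1 = l2).
  by exists y1 => //; rewrite (proj_line_eq ll ll1 t12) // l12.
have y12 : y1 <> y2.
  move=> e; apply: l12; apply: (proj_line_eq ll1 ll2 (neqz Yy1)) => //.
  by rewrite e.
have [m [lm my1 my2]] := proj_line y12.
case: proj_PG => _ _ veblen.
have [k [lk mk]] := veblen _ _ _ _ _ _ _ _ _ ll1 ll2 ll lm l12
  (And3 l1z l1t1 l1y1) (And3 l2z l2t2 l2y2)
  (And4 t1z (neqz Yy1) t2z (neqz Yy2)) lt1 lt2 my1 my2.
by exists k => //; apply: (sY lm my1 my2 y12).
Qed.

(** The line [l] meets [Y] in some [k]; let [s <> k] be a point of [l] on a line from [z] to [y1].
    The Veblen-Young axiom at [s] makes the line on [y1] and [k], contained in [Y], meet the line on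
    [t] and [z]. *)
Lemma cone_subspace : subspace (cone Y z).
Proof.
move=> l t1 t2 ll lt1 lt2 t12 ct1 ct2 t lt.
have [k Yk lk] := cone_line_meets ll t12 lt1 lt2 ct1 ct2.
have [s [ls cs sk]] : exists s, [/\ l s, cone Y z s & s <> k].
  have [e|] := pselect (t1 = k); last by exists t1.
  by exists t2; split => // e2; apply: t12; rewrite e.
have [->|ts] := pselect (t = s); first by [].
have [->|tk] := pselect (t = k); first exact: sub_cone.
have [tz|tz] := pselect (t = z); first by left.
case: cs => [sz|[y1 [l1 [Yy1 ll1 l1z l1y1 l1s]]]].
  by right; exists k, l; split => //; rewrite -sz.
have [ll1E|ll1E] := pselect (l1 = l).
  by right; exists y1, l1; split => //; rewrite ll1E.
have y1k : y1 <> k.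
  by move=> e; apply: ll1E; apply: (proj_line_eq ll1 ll sk) => //; rewrite -e.
have [y1s|y1s] := pselect (y1 = s).
  by apply: sub_cone; apply: (sY ll ls lk sk) => //; rewrite -y1s.
have [sz|sz] := pselect (z = s).
  by right; exists k, l; split => //; rewrite sz.
have [m1 [lm1 m1y1 m1k]] := proj_line y1k.
have [m2 [lm2 m2t m2z]] := proj_line tz.
case: proj_PG => _ _ veblen.
have [y [m1y m2y]] := veblen _ _ _ _ _ _ _ _ _ ll1 ll lm1 lm2 ll1E
  (And3 l1s l1y1 l1z) (And3 ls lk lt) (And4 y1s sz (nesym sk) ts)
  m1y1 m1k m2z m2t.
by right; exists y, m2; split => //; apply: (sY lm1 m1y1 m1k y1k).
Qed.

End Projective.

(** * Tangents and secants of an embedded polar space *)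

Section Embedding.
Variables (S PG : geometry) (e : S -> PG).
Hypotheses (polar_S : polar_space S) (thick_S : thick_lined S).
Hypotheses (nondeg_S : nondegenerate S) (lines_S : spans_line [set: S]).
Hypotheses (proj_PG : projective_space PG) (emb : full_projective_embedding e).
Implicit Types (a b x y s : S) (l m : set S) (t h k : PG) (Z : set PG).

Let e_inj : injective e. Proof. by case: emb. Qed.
Let e_line l : line l -> line (e @` l). Proof. by case: emb => _ _; apply. Qed.
Let e_image l x : l x -> (e @` l) (e x). Proof. by move=> lx; exists x. Qed.

Lemma subspace_preimage Z : subspace Z -> subspace (e @^-1` Z).
Proof.
move=> sZ l x y ll lx ly xy Zx Zy t lt.
apply: (sZ _ _ _ (e_line ll) (e_image lx) (e_image ly) _ Zx Zy _ (e_image lt)).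
by move/e_inj.
Qed.

Definition tangent a : set PG := span (e @` collinear a).

(** The enlargement step for the Zorn argument in [tangentP]. If [b] violates the claim, let [u] be
    its projection on the line of [a] and [z]. The line on [b] and [u] meets [Z] in a point [k]
    collinear with [a]: [k <> u] gives [a _|_ b], while [k = u] puts [z] in [Z]. *)
Lemma cone_tangent Z a z : subspace Z -> Z (e a) ->
  (forall y, Z (e y) -> a _|_ y) -> a _|_ z -> ~ Z (e z) ->
  forall y, cone Z (e z) (e y) -> a _|_ y.
Proof.
move=> sZ Za Zperp az Zz b cb; apply: contrapT => ab.
have aDz : a <> z by move=> E; apply: Zz; rewrite -E.
have [l [ll la lz]] := collinear_line az aDz.
have sC := cone_subspace proj_PG sZ Zz.
have ca : cone Z (e z) (e a) by apply: (sub_cone proj_PG Zz).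
have [u lu bu] := line_proj polar_S thick_S b ll.
have ua : u <> a by move=> E; apply: ab; rewrite -E; apply: collinear_sym.
have cu : cone Z (e z) (e u).
  exact: (subspace_preimage sC ll la lz aDz ca (cone_vertex Z (e z)) lu).
have bDu : b <> u by move=> E; apply: ab; rewrite E; apply: collinear_on la lu.
have [m [lm mb mu]] := collinear_line bu bDu.
have [q Zk [k mk kE]] := cone_line_meets proj_PG sZ Zz (e_line lm)
  (fun E => bDu (e_inj E)) (e_image mb) (e_image mu) cb cu.
rewrite -{q}kE in Zk.
have [ku|ku] := pselect (k = u).
  apply: Zz; apply: (subspace_preimage sZ ll la lu (nesym ua) Za) => //.
  by rewrite -ku.
apply: ab; apply: (line_all polar_S lm mk mu mb ku (Zperp _ Zk)).
exact: collinear_on la lu.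
Qed.

(** A maximal subspace on [e a] whose points of [S] are all collinear with [a] contains the image of
    the perp of [a], since otherwise a cone over it would be larger. So it contains the tangent. *)
Lemma tangentP a y : tangent a (e y) <-> a _|_ y.
Proof.
split; last by move=> ay; apply: sub_span; exists y.
pose good Z := [/\ subspace Z, Z (e a) & forall y, Z (e y) -> a _|_ y].
have [A [PA maxA]] : exists A, (A = set0 \/ good A) /\
    forall B, A `<` B -> ~ (B = set0 \/ good B).
  apply: (@Zorn_bigcup _ [set Z | Z = set0 \/ good Z]) => F FP totF.
  have [[X FX goodX]|no] := pselect (exists2 X, F X & good X); last first.
    left; apply/seteqP; split=> // t [X FX Xt].
    by case: (FP X FX) => [X0|goodX]; [rewrite X0 in Xt|case: no; exists X].
  right; split; last 1 first.
  - move=> x [Y FY Yx]; case: (FP Y FY) => [Y0|[_ _]]; last exact.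
    by rewrite Y0 in Yx.
  - move=> l x y' ll lx ly xy [X1 FX1 X1x] [X2 FX2 X2y] t lt.
    have [Y FY [Yx Yy]] : exists2 Y, F Y & Y x /\ Y y'.
      case: (totF _ _ FX1 FX2) => h; [exists X2|exists X1] => //; split => //;
        exact: h.
    exists Y => //; case: (FP Y FY) => [Y0|[sY _ _]]; first by rewrite Y0 in Yx.
    exact: (sY l x y').
  - by exists X => //; case: goodX.
have goodA : good A.
  case: PA => // A0; case: (maxA [set e a]).
    by rewrite A0; split=> // /(_ (e a) erefl).
  right; split=> // [l x x' _ _ _ xx' xa x'a|x /= /e_inj ->]; last by left.
  by case: xx'; rewrite xa x'a.
have [sA Aa Aperp] := goodA.
suff : tangent a `<=` A by move=> sub /sub /Aperp.
apply: span_sub => // _ [z az <-]; apply: contrapT => Az.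
apply: (maxA (cone A (e z))).
  split; first exact: sub_cone.
  by move=> /(_ _ (cone_vertex A (e z))).
right; split; first exact: cone_subspace.
  exact: sub_cone.
exact: cone_tangent.
Qed.

(** Every line of [S] meets the perp of [a], so membership in [Z] spreads along lines between points
    off that perp, which [off_perp_ind] connects. *)
Lemma tangent_spans Z a b : subspace Z -> (forall y, a _|_ y -> Z (e y)) ->
  ~ a _|_ b -> Z (e b) -> Z = [set: PG].
Proof.
move=> sZ Za ab Zb; have [_ spanS _] := emb.
apply/seteqP; split => //; rewrite -spanS; apply: span_sub => // _ [y _ <-].
have [ay|ay] := pselect (a _|_ y); first exact: Za.
apply: (off_perp_ind polar_S thick_S (@subspaceT S) (nondeg_onT nondeg_S)
  lines_S (Q := fun y => Z (e y)) _ I I ab ay Zb).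
move=> x x' _ _ ax ax' xx' xDx' Zx.
have [l [ll lx lx']] := collinear_line xx' xDx'.
have [u lu au] := line_proj polar_S thick_S a ll.
have xDu : x <> u by move=> E; apply: ax; rewrite E.
by apply: (subspace_preimage sZ ll lx lu xDu Zx _ lx'); apply: Za.
Qed.

Lemma tangent_meets a (l : set PG) : line l -> exists2 k, tangent a k & l k.
Proof.
move=> ll; have [b ab] := opposite_exists nondeg_S a.
have sT : subspace (tangent a) by exact: span_subspace.
have Tb : ~ tangent a (e b) by move=> /tangentP.
have coneT : cone (tangent a) (e b) = [set: PG].
  apply: (@tangent_spans _ a b) => //; first exact: cone_subspace.
    by move=> y ay; apply: sub_cone => //; apply/tangentP.
  exact: cone_vertex.
have [thick_PG _ _] := proj_PG; have [p lp _] := line_two thick_PG (e a) ll.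
have [q lq qp] := line_two thick_PG p ll.
by apply: (cone_line_meets proj_PG sT Tb ll qp lq lp); rewrite coneT.
Qed.

Definition secant x t : Prop :=
  exists s (l : set PG), [/\ s <> x, line l, l (e x), l (e s) & l t].

(* The secants through [x], seen in the quotient at [x], form a set closed under
   the translations in the directions of the lines of [S] on [x]; these
   directions span the hyperplane at infinity. *)
Lemma secant_tangent x (s h t : PG) (l : set PG) : tangent x h -> secant x s ->
  ~ tangent x s -> ~ tangent x t -> line l -> l s -> l t -> l h -> secant x t.
Proof.
pose F := [set h | tangent x h /\ forall (s t : PG) (l : set PG),
  secant x s -> ~ tangent x s -> ~ tangent x t -> line l ->
  l s -> l t -> l h -> secant x t].
have Tx : tangent x (e x) by apply/tangentP; left.
have sT : subspace (tangent x) by exact: span_subspace.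
suff {s h t l} TF : tangent x `<=` F.
  by move=> Th hs; case: (TF h Th) => _; apply; first exact: hs.
apply: span_sub.
  move=> l h1 h2 ll lh1 lh2 h12 [Th1 F1] [Th2 F2] h lh.
  have Th : tangent x h by apply: (sT l h1 h2).
  split=> // s t m ss Ts Tt lm ms mt mh.
  have sh1 : s <> h1 by move=> E; apply: Ts; rewrite E.
  have [n [ln ns nh1]] := proj_line proj_PG sh1.
  have nT k : n k -> tangent x k -> k = h1.
    move=> nk Tk; apply: contrapT => kh1; apply: Ts.
    exact: (sT n k h1).
  have nh2 : ~ n h2 by move=> /nT /(_ Th2) E; apply: h12.
  have sn : subspace n.
    move=> n' x1 x2 ln' n'x1 n'x2 x12 nx1 nx2.
    by rewrite (proj_line_eq proj_PG ln' ln x12).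
  have sC := cone_subspace proj_PG sn nh2.
  have ch1 : cone n h2 h1 by apply: (sub_cone proj_PG nh2).
  have cs : cone n h2 s by apply: (sub_cone proj_PG nh2).
  have ch : cone n h2 h.
    by apply: (sC l h1 h2) => //; apply: cone_vertex.
  have sh : s <> h by move=> E; apply: Ts; rewrite E.
  (* In the plane on [n] and [h2], the translation from [s] to [t] splits into one towards [h1],
     from [s] to [y], and one towards [h2], from [y] to [t]. *)
  have [th2|[y [k [ny lk kh2 ky kt]]]] : cone n h2 t by apply: (sC m s h).
    by case: Tt; rewrite th2.
  have Ty : ~ tangent x y.
    move=> Ty; apply: Tt; apply: (sT k y h2) => //.
    by move=> E; apply: nh2; rewrite -E.
  exact: (F2 y t k (F1 s y n ss Ts Ty ln ns ny nh1) Ty Tt).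
move=> _ [z xz <-]; split; first exact/tangentP.
move=> s t l [s' [m [s'x lm mx ms' ms]]] Ts Tt ll ls lt lz.
have xs' : ~ x _|_ s'.
  move=> /tangentP Ts'; apply: Ts; apply: (sT m (e x) (e s')) => //.
  by move=> /e_inj E; apply: s'x.
have [zx|xDz] := pselect (x = z).
  exists s', m; split=> //;
    rewrite (proj_line_eq proj_PG lm ll (x := s) (y := e x)) //.
    by move=> E; apply: Ts; rewrite E.
  by rewrite zx.
have [n [ln nx nz]] := collinear_line xz xDz.
have [z' nz' s'z'] := line_proj polar_S thick_S s' ln.
have s'Dz' : s' <> z' by move=> E; apply: xs'; rewrite E;
  apply: collinear_on nx nz'.
have [g [lg gs' gz']] := collinear_line s'z' s'Dz'.
have z'x : z' <> x by move=> E; apply: xs'; rewrite -E; apply: collinear_sym.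
have gx : ~ (e @` g) (e x).
  move=> [x' gx' /e_inj E]; apply: xs'; rewrite -E.
  exact: collinear_on gx' gs'.
have lG := e_line lg.
have sG : subspace (e @` g).
  move=> n' x1 x2 ln' n'x1 n'x2 x12 nx1 nx2.
  by rewrite (proj_line_eq proj_PG ln' lG x12).
have sC := cone_subspace proj_PG sG gx.
have cx := cone_vertex (e @` g) (e x).
have cs' : cone (e @` g) (e x) (e s') by apply: (sub_cone proj_PG gx);
  apply: e_image.
have cz' : cone (e @` g) (e x) (e z') by apply: (sub_cone proj_PG gx);
  apply: e_image.
have cs : cone (e @` g) (e x) s.
  apply: (sC m (e x) (e s') lm mx ms' _ cx cs') => //.
  by move=> /e_inj E; apply: s'x.
have cz : cone (e @` g) (e x) (e z).
  exact: (subspace_preimage sC ln nx nz' (nesym z'x) cx cz').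
have sz : s <> e z by move=> E; apply: Ts; rewrite E; apply/tangentP.
have [tx|[_ [k [[y gy <-] lk kx ky kt]]]] : cone (e @` g) (e x) t.
  by apply: (sC l s (e z)).
  by case: Tt; rewrite tx.
exists y, k; split => // E; apply: gx; rewrite -E; exact: e_image.
Qed.

(** Start from [e b] with [b] opposite [x] and translate towards the point where the line on [t] and
    [e b] meets the tangent at [x]. *)
Lemma secant_off_tangent x t : ~ tangent x t -> secant x t.
Proof.
move=> Tt; have [b xb] := opposite_exists nondeg_S x.
have bx : b <> x by move=> E; apply: xb; rewrite E; left.
have [l [ll lx lb]] := proj_line proj_PG (fun E => bx (esym (e_inj E))).
have sb : secant x (e b) by exists b, l.
have [tb|tb] := pselect (t = e b); first by rewrite tb.
have [m [lm mt mb]] := proj_line proj_PG tb.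
have [h Th mh] := tangent_meets x lm.
apply: (secant_tangent Th sb _ Tt lm mb mt mh).
by move=> /tangentP.
Qed.

(** Otherwise [t] lies on a secant through [x'] and some [s]. The tangents at [x] and [a] contain
    [t] and [e x'], hence [e s]; so [s] is collinear with [x] and [a], hence with [x'], and the
    secant lies in the tangent at [x']. *)
Lemma tangent_pencil x a x' l t : line l -> l x -> l a -> l x' -> x <> a ->
  tangent x t -> tangent a t -> tangent x' t.
Proof.
move=> ll lx la lx' xa Tx Ta; apply: contrapT => Tx'.
have [s [m [sx' lm mx' ms mt]]] := secant_off_tangent Tx'.
have tx' : t <> e x' by move=> E; apply: Tx'; rewrite E; apply/tangentP; left.
have perp_s y : tangent y t -> l y -> y _|_ s.
  move=> Ty ly; apply/tangentP.
  apply: (span_subspace lm mt mx' tx' Ty _ ms).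
  by apply/tangentP; apply: collinear_on ly lx'.
apply: Tx'; apply: (span_subspace lm mx' ms _ _ _ mt).
- by move=> /e_inj E; apply: sx'.
- by apply/tangentP; left.
apply/tangentP; apply: collinear_sym.
by apply: (line_all polar_S ll lx la lx' xa); apply: collinear_sym;
  apply: perp_s.
Qed.

Lemma embedded_sliding (r : S) : sliding r.
Proof.
move=> a b d z l ab Pr ll lr lb ld dr Hz.
have [ar br] := (perp2E a b r).1 Pr.
have bDr : b <> r by move=> E; apply: ab; rewrite E.
have rz : r _|_ z by apply: Hz.
have rDz : r <> z.
  by move=> E; apply: (hyperbolic_disjoint polar_S thick_S nondeg_S ab Hz);
    rewrite -E.
have [m [lm mr mz]] := collinear_line rz rDz.
have [db|db] := pselect (d = b); first by rewrite db; exists z => //; exists m.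
have ad : ~ a _|_ d.
  by move=> ad; apply: ab; apply: (line_all polar_S ll ld lr lb dr ad).
have [zb|zb] := pselect (z = b).
  exists d; last by exists l; rewrite zb.
  by apply: sub_perpK; right.
have [x0 Px0 rx0] := trace_nondeg polar_S thick_S nondeg_S ab Pr.
have lz : ~ l z.
  move=> lz; apply: rx0; apply: collinear_sym.
  apply: (line_all polar_S ll lz lb lr zb); first exact: Hz.
  by apply: collinear_sym; have [] := (perp2E a b x0).1 Px0.
have [n [ln nb nz]] := proj_line proj_PG (fun E => zb (esym (e_inj E))).
have [k Tk nk] := tangent_meets a ln.
have kb : k <> e b by move=> E; apply: ab; apply/tangentP; rewrite -E.
have lDn : e @` l <> n.
  by move=> E; move: nz; rewrite -E => -[z' lz' /e_inj zE]; apply: lz;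
    rewrite -zE.
have dk : e d <> k.
  move=> E; apply: lDn; apply: (proj_line_eq proj_PG (e_line ll) ln kb) => //.
  by rewrite -E; apply: e_image.
have [g [lg gd gk]] := proj_line proj_PG dk.
have [_ _ veblen] := proj_PG.
(* The Veblen-Young axiom at [e b]: the line on [e d] and [k] meets the image of the line on [r] and
   [z]. *)
have [q [gw [w mw wE]]] :=
  veblen _ _ _ _ _ _ _ _ _ (e_line ll) ln lg (e_line lm)
  lDn (And3 (e_image lb) (e_image ld) (e_image lr)) (And3 nb nk nz)
  (And4 (fun E => db (e_inj E)) (fun E => bDr (esym (e_inj E))) kb
    (fun E => zb (e_inj E))) gd gk (e_image mr) (e_image mz).
rewrite -{q}wE in gw; exists w; last by exists m.
move=> y' /perp2E [ay' dy'].
have aDy' : a <> y' by move=> E; apply: ad; rewrite E; apply: collinear_sym.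
have [h [lh ha hy']] := collinear_line ay' aDy'.
have [y hy b_y] := line_proj polar_S thick_S b lh.
have yDa : y <> a by move=> E; apply: ab; rewrite -E; apply: collinear_sym.
have Py : perp [set a; b] y.
  by apply/perp2E; split => //; apply: collinear_on ha hy.
have Tyk : tangent y k.
  apply: (span_subspace ln nb nz (fun E => zb (esym (e_inj E))) _ _ nk).
    by apply/tangentP; apply: collinear_sym.
  by apply/tangentP; apply: Hz.
apply/tangentP; apply: (span_subspace lg gd gk dk _ _ gw).
  by apply/tangentP; apply: collinear_sym.
exact: (tangent_pencil lh hy ha hy' yDa).
Qed.

End Embedding.

(** * The perp of two sub-generators *)

Lemma automorphism_collinear (S : geometry) (g : S -> S) x y :
  automorphism g -> g x _|_ g y <-> x _|_ y.
Proof.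
move=> [[h gK hK] g_line]; split=> [[/(can_inj gK) ->|[l [ll lx ly]]]|].
- exact: collinear_refl.
- right; exists (g @^-1` l); split=> //; apply/g_line.
  suff -> : g @` (g @^-1` l) = l by [].
  by apply/seteqP; split=> [_ [t lt <-] //|t lt]; exists (h t); rewrite /= hK.
- case=> [->|[l [ll lx ly]]]; first exact: collinear_refl.
  by apply: (@collinear_on _ (g @` l)); [apply: (g_line l).1|exists x|exists y].
Qed.

Section SubGenerators.
Variable S : geometry.
Hypotheses (polar_S : polar_space S) (thick_S : thick_lined S).
Hypothesis nondeg_S : nondegenerate S.
Implicit Types (x y z a b c d r : S) (l M N : set S).

Lemma generator_absorbs M x : generator M -> perp M x -> M x.
Proof.
move=> [[sM singM] maxM] Mx; pose A := M `|` [set x].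
have AA : A `<=` perp A.
  move=> y [My|->]; apply/perpU; split=> //.
  - by move=> z Mz; apply: singM.
  - by apply/perp1E/collinear_sym; apply: Mx.
  - by apply/perp1E; left.
rewrite -(maxM (span A)).
- by apply: sub_span; right.
- split; first exact: span_subspace.
  by move=> y z Ay Az; apply: (span_perp polar_S AA Az).
- by move=> y My; apply: sub_span; left.
Qed.

(** A point [m] of [M] off [N] generates [M] together with [N], so by [absorb] a point of the perp
    of [N] collinear with [m] is in [M]. Projecting [m] on [l] gives a point of [M]; if it is not in
    [N], all of [l] is in [M] and meets the hyperplane [N]. *)
Lemma line_meets_sub_generator N l : sub_generator N -> line l ->
  l `<=` perp N -> exists2 q, N q & l q.
Proof.
move=> [_ [M [gM [_ ltNM meetM]]]] ll lN.
have [sM singM] := gM.1.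
have absorb m x : M m -> ~ N m -> perp N x -> m _|_ x -> M x.
  move=> Mm Nm Nx mx; apply: generator_absorbs => // t Mt.
  have [<- //|mt] := pselect (m = t).
  have [k [lk km kt]] := collinear_line (singM _ _ Mm Mt) mt.
  have [q [Nq kq]] := meetM k lk (sM k m t lk km kt mt Mm Mt).
  have qm : q <> m by move=> E; apply: Nm; rewrite -E.
  apply: collinear_sym; apply: (line_all polar_S lk kq km kt qm).
    by apply: collinear_sym; apply: Nx.
  exact: collinear_sym.
apply: contrapT => no.
have lNM x : l x -> ~ M x.
  move=> lx Mx; have Nx : ~ N x by move=> Nx; apply: no; exists x.
  have lM : l `<=` M.
    by move=> y ly; apply: (absorb x) => //;
      [apply: lN|apply: collinear_on lx ly].
  by have [q [Nq lq]] := meetM l ll lM; apply: no; exists q.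
have [m Mm Nm] := proper_point ltNM.
have [q lq mq] := line_proj polar_S thick_S m ll.
by apply: (lNM q lq); apply: (absorb m) => //; apply: lN.
Qed.

(** Otherwise the empty set, [[set r]], [N] and a generator on [N] form a chain of length three. *)
Lemma rank2_sub_generator N r : sub_generator N -> ~ rank_ge S 3 -> N r ->
  N = [set r].
Proof.
move=> [sN [M [[sM _] [_ ltNM _]]]] rk3 Nr.
apply: contrapT => NDr; apply: rk3.
exists (fun i => match i with 0 => set0 | 1 => [set r] | 2 => N | _ => M end).
have subr : [set r] `<=` N by move=> x ->.
split.
- case=> [|[|[|[|//]]]] _ //; split=> //.
  + by move=> l x y _ _ _ xy xr yr; case: xy; rewrite xr yr.
  + by move=> x y -> ->; left.
- case=> [|[|[|//]]] _ //; split=> //.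
  + by move=> /(_ r erefl).
  + by move=> Nsub; apply: NDr; apply/seteqP.
Qed.

Variables N N' : set S.
Hypotheses (sub_N : sub_generator N) (sub_N' : sub_generator N').
Let R := N `&` N'.
Let X := perp (N `|` N').

(* Every line of [X] meets [R], so collinearity is an equivalence relation on
   the points of [X] off [R]: the hyperbolic line must meet all classes. *)
Definition reaches a b : Prop :=
  forall x, X x -> exists2 y, perp (perp [set a; b]) y & x _|_ y.

Let R_perp r x : R r -> X x -> r _|_ x.
Proof. by move=> [Nr _] Xx; apply: Xx; left. Qed.

Let R_sub : R `<=` X.
Proof.
move=> r [Nr N'r]; have [[[_ singN] _] [[_ singN'] _]] := (sub_N, sub_N').
by apply/perpU; split=> x ?; [apply: singN|apply: singN'].
Qed.

Let sX : subspace X. Proof. exact: subspace_perp. Qed.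

Section OppositePair.
Variables a b : S.
Hypotheses (opp_ab : ~ a _|_ b) (Xa : X a) (Xb : X b).
Let H := perp (perp [set a; b]).

(** If [x] is not in [N'], the line on [x] and [a] is in the perp of [N'] and meets [N'] in some
    [q <> x]. Then [b] is collinear with [q] and [x], hence with [a]. *)
Lemma sub_generator_perp_inter x : N x -> X x -> N' x.
Proof.
move=> Nx Xx; apply: contrapT => N'x.
have [xa xb] : x _|_ a /\ x _|_ b by split; [apply: Xa|apply: Xb]; left.
have xDa : x <> a by move=> E; apply: opp_ab; rewrite -E.
have [l [ll lx la]] := collinear_line xa xDa.
have lN' : l `<=` perp N'.
  have sN' : subspace (perp N') by apply: subspace_perp.
  by apply: (sN' l x a) => //;
    [case: ((perpU N N' x).1 Xx)|case: ((perpU N N' a).1 Xa)].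
have [q N'q lq] := line_meets_sub_generator sub_N' ll lN'.
have qx : q <> x by move=> E; apply: N'x; rewrite -E.
apply: opp_ab; apply: collinear_sym; apply: (line_all polar_S ll lq lx la qx).
  by apply: collinear_sym; apply: Xb; right.
exact: collinear_sym.
Qed.

Lemma line_meets_radical l : line l -> l `<=` X -> exists2 r, R r & l r.
Proof.
move=> ll lX; have lN : l `<=` perp N by move=> x /lX /perpU [].
have [q Nq lq] := line_meets_sub_generator sub_N ll lN.
by exists q => //; split=> //; apply: sub_generator_perp_inter => //; apply: lX.
Qed.

Lemma collinear_trans_radical x y z : X x -> X y -> X z -> ~ R y ->
  x _|_ y -> y _|_ z -> x _|_ z.
Proof.
move=> Xx Xy Xz Ry xy yz; have [-> //|xDy] := pselect (x = y).
have [l [ll lx ly]] := collinear_line xy xDy.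
have [r Rr lr] := line_meets_radical ll (sX ll lx ly xDy Xx Xy).
have ry : r <> y by move=> E; apply: Ry; rewrite -E.
apply: collinear_sym; apply: (line_all polar_S ll lr ly lx ry).
  by apply: collinear_sym; apply: R_perp.
exact: collinear_sym.
Qed.

Lemma radical_trace : R `<=` perp [set a; b].
Proof. by move=> r Rr; apply/perp2E; split; apply: collinear_sym;
  apply: R_perp. Qed.

Lemma hyperbolic_sub : H `<=` X.
Proof. by apply: perpS; apply: perp_sym => x [->|->]. Qed.

Lemma hyperbolic_radical y : H y -> ~ R y.
Proof.
move=> Hy /radical_trace.
exact: (hyperbolic_disjoint polar_S thick_S nondeg_S opp_ab).
Qed.

(** A point collinear with [y] in [H] is [y] or is on a line joining [y] to a point of [R].
    Conversely, the points of [X] collinear with some point of [H] form a subspace [W] containing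
    [R] and [H]. *)
Lemma span_hyperbolicP : X = span (R `|` H) <-> reaches a b.
Proof.
split=> [XE|reach]; last first.
  apply/seteqP; split; last first.
    by apply: span_sub => // x [/R_sub|/hyperbolic_sub].
  move=> x Xx; have [y Hy xy] := reach x Xx.
  have Sy : span (R `|` H) y by apply: sub_span; right.
  have [-> //|xDy] := pselect (x = y).
  have [l [ll lx ly]] := collinear_line xy xDy.
  have [r Rr lr] := line_meets_radical ll (sX ll lx ly xDy Xx (hyperbolic_sub
    Hy)).
  have ry : r <> y by move=> E; apply: (hyperbolic_radical Hy); rewrite -E.
  by apply: (span_subspace ll lr ly ry _ Sy lx); apply: sub_span; left.
pose W := [set x | X x /\ exists2 y, H y & x _|_ y].
suff XW : X `<=` W by move=> x /XW [].
rewrite [in X in X `<=` _]XE; apply: span_sub; last first.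
  move=> x [Rx|Hx]; split; first exact: R_sub.
  - exists a; first by apply: sub_perpK; left.
    exact: R_perp.
  - exact: hyperbolic_sub.
  - by exists x => //; left.
move=> l x y ll lx ly xy [Xx [u Hu xu]] [Xy [v Hv yv]] t lt.
split; first exact: (sX ll lx ly xy).
have [Xu Xv] := (hyperbolic_sub Hu, hyperbolic_sub Hv).
have [Rx|Rx] := pselect (R x).
  exists v => //; apply: collinear_sym;
    apply: (line_all polar_S ll lx ly lt xy).
    by apply: collinear_sym; apply: R_perp.
  exact: collinear_sym.
exists u => //; apply: collinear_sym; apply: (line_all polar_S ll lx ly lt xy).
  exact: collinear_sym.
apply: collinear_sym; apply: (collinear_trans_radical _ Xx) => //.
exact: collinear_on ly lx.
Qed.

(** The line on [b] and [d] has a point [r] of [R] along which to slide. A point of [X] collinear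
    with [z] is also collinear with [r], hence with the point [w] that replaces [z]. *)
Lemma reaches_slide d : (forall r, R r -> sliding r) -> X d -> ~ R d ->
  b _|_ d -> reaches a b -> reaches a d.
Proof.
move=> slide Xd Rd bd reach; have [<- //|bDd] := pselect (b = d).
have [l [ll lb ld]] := collinear_line bd bDd.
have [r Rr lr] := line_meets_radical ll (sX ll lb ld bDd Xb Xd).
have dr : d <> r by move=> E; apply: Rd; rewrite E.
move=> x Xx; have [z Hz xz] := reach x Xx.
have [w Hw [m [lm mr mz mw]]] :=
  slide r Rr a b d z l opp_ab (radical_trace Rr) ll lr lb ld dr Hz.
exists w => //; apply: (line_all polar_S lm mr mz mw _ _ xz).
  by move=> E; apply: (hyperbolic_radical Hz); rewrite -E.
by apply: collinear_sym; apply: R_perp.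
Qed.

End OppositePair.

Lemma reaches_sym a b : reaches a b -> reaches b a.
Proof. by rewrite /reaches setUC. Qed.

(** Choose [c'] and [d'] on the hyperbolic line of [a] and [b], collinear with [c] and [d]. They are
    opposite and determine the same hyperbolic line; then [d'] slides to [d], and [c'] to [c]. *)
Lemma reaches_transfer a b c d : (forall r, R r -> sliding r) ->
  ~ a _|_ b -> ~ c _|_ d -> X a -> X b -> X c -> X d ->
  reaches a b -> reaches c d.
Proof.
move=> slide ab cd Xa Xb Xc Xd reach.
have [c' Hc' cc'] := reach c Xc; have [d' Hd' dd'] := reach d Xd.
have [Xc' Xd'] := (hyperbolic_sub Xa Xb Hc', hyperbolic_sub Xa Xb Hd').
have Rc' := hyperbolic_radical ab Xa Xb Hc'.
have Rd' := hyperbolic_radical ab Xa Xb Hd'.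
have Rc : ~ R c by move=> Rc; apply: cd; apply: R_perp.
have Rd : ~ R d by move=> Rd; apply: cd; apply: collinear_sym; apply: R_perp.
have trans x y z := @collinear_trans_radical a b ab Xa Xb x y z.
have dc' : ~ d _|_ c'.
  by move=> dc'; apply: cd; apply: (trans c c' d) => //; apply: collinear_sym.
have c'd' : ~ c' _|_ d'.
  move=> c'd'; apply: dc'; apply: (trans d d' c') => //; exact: collinear_sym.
have reach' : reaches c' d'.
  by rewrite /reaches (trace_eq polar_S thick_S nondeg_S ab c'd').
apply: reaches_sym; apply: (@reaches_slide d c') => //;
  first exact: collinear_sym.
apply: reaches_sym; apply: (@reaches_slide c' d') => //; exact: collinear_sym.
Qed.

End SubGenerators.

Lemma reaches_transitive (S : geometry) (p a b c d : S) :
  stabilizer_transitive p -> ~ a _|_ b -> ~ c _|_ d ->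
  perp [set p] a -> perp [set p] b -> perp [set p] c -> perp [set p] d ->
  reaches [set p] [set p] a b -> reaches [set p] [set p] c d.
Proof.
move=> tr ab cd pa pb pc pd; rewrite /reaches setUid => reach.
have hyp x y : perp [set p] x -> perp [set p] y ->
    perp (perp [set x; y]) `<=` perp [set p].
  by move=> px py; apply: perpS; apply: perp_sym => t [->|->].
have [g [gA gp gE]] := tr (perp (perp [set a; b])) (perp (perp [set c; d]))
  (ex_intro _ a (ex_intro _ b (conj ab erefl))) (hyp _ _ pa pb)
  (ex_intro _ c (ex_intro _ d (conj cd erefl))) (hyp _ _ pc pd).
have [[h gK hK] _] := gA.
move=> x /perp1E px; have [|y Hy xy] := reach (h x).
  by apply/perp1E; apply/(automorphism_collinear _ _ gA); rewrite gp hK.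
exists (g y); first by rewrite -gE; exists y.
by rewrite -[x]hK; apply/(automorphism_collinear _ _ gA).
Qed.

Theorem theorem3p5 (S : geometry)
  (polar_S : polar_space S) (nondeg_S : nondegenerate S)
  (thick_S : thick_lined S) (rank_S : rank_ge S 2)
  (N N' : set S) (sub_N : sub_generator N) (sub_N' : sub_generator N')
  (a b c d : S) (opp_ab : opposite a b) (opp_cd : opposite c d)
  (perp_ab : [set a; b] `<=` perp (N `|` N'))
  (perp_cd : [set c; d] `<=` perp (N `|` N'))
  (not_exceptional :
     ~ [/\ ~ embeddable S, rank_eq S 2, N = N' &
           exists p : S, N = [set p] /\ ~ stabilizer_transitive p]) :
  perp (N `|` N') = span ((N `&` N') `|` perp (perp [set a; b])) <->
  perp (N `|` N') = span ((N `&` N') `|` perp (perp [set c; d])).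
Proof.
have [Xa Xb] := (perp_ab a (or_introl erefl), perp_ab b (or_intror erefl)).
have [Xc Xd] := (perp_cd c (or_introl erefl), perp_cd d (or_intror erefl)).
have spanP x y := @span_hyperbolicP S polar_S thick_S nondeg_S N N' sub_N sub_N' x y.
rewrite (spanP a b opp_ab Xa Xb) (spanP c d opp_cd Xc Xd).
have [slide|noslide] := pselect (forall r, (N `&` N') r -> sliding r).
  by split; apply: reaches_transfer.
(* If sliding fails at some [r], then [S] has rank 2 and is not embeddable, and [N = N' = [set r]];
   the excluded case leaves a transitive stabilizer. *)
have [r [Nr N'r] nsl] : exists2 r, (N `&` N') r & ~ sliding r.
  apply: contrapT => no; apply: noslide => r Rr.
  by apply: contrapT => nsl; apply: no; exists r.
have rk3 : ~ rank_ge S 3.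
  move=> rk3; apply: nsl; apply: trace_sliding => // x y.
  exact: rank3_trace_spans_line.
have nemb : ~ embeddable S.
  move=> [PG [e [projPG emb]]]; apply: nsl.
  exact: (embedded_sliding polar_S thick_S nondeg_S (rank2_spans_line rank_S) projPG emb).
have NE := rank2_sub_generator sub_N rk3 Nr.
have N'E := rank2_sub_generator sub_N' rk3 N'r.
have tr : stabilizer_transitive r.
  apply: contrapT => ntr; apply: not_exceptional; split=> //.
    by rewrite NE N'E.
  by exists r.
move: Xa Xb Xc Xd; rewrite NE N'E setUid => Xa Xb Xc Xd.
by split; apply: reaches_transitive.
Qed.
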